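(* Let $L$ be a locally compact Hausdorff topological space with at least two points and let $E$ be any non-zero (real or complex) Banach space. Then $\Phi_{C_0(L,E)}(\delta)=\Phi_{C_0(L,E)}^S(\delta)=\sqrt{2\delta}$ for every $\delta\in(0,1/2]$.
   Context: For a (real or complex) Banach space $X\neq\{0\}$, $B_X$ and $S_X$ denote its closed unit ball and unit sphere, $X^*$ its topological dual, and $\Pi(X):=\{(x,x^* )\in X\times X^* : \|x\|=\|x^*\|=x^*(x)=1\}$. The Bishop-Phelps-Bollobás modulus $\Phi_X:(0,2)\to[0,\infty)$ is defined as follows: $\Phi_X(\delta)$ is the infimum of those $\varepsilon>0$ such that for every $(x,x^* )\in B_X\times B_{X^*}$ with $\operatorname{Re} x^*(x)>1-\delta$ there is $(y,y^* )\in\Pi(X)$ with $\|x-y\|<\varepsilon$ and $\|x^*-y^*\|<\varepsilon$. The spherical Bishop-Phelps-Bollobás modulus $\Phi_X^S:(0,2)\to[0,\infty)$ is defined in the same way with $B_X\times B_{X^*}$ replaced by $S_X\times S_{X^*}$. $C_0(L,E)$ is the Banach space of continuous functions $f:L\to E$ vanishing at infinity, with the supremum norm. *)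

(* Defs.v *)
From HB Require Import structures.
From mathcomp Require Import all_boot all_order all_algebra.
From mathcomp Require Import all_classical all_reals all_analysis.
From mathcomp Require Import complex.

Set Implicit Arguments.
Unset Strict Implicit.
Unset Printing Implicit Defensive.

Import Order.TTheory GRing.Theory Num.Theory.
Import numFieldNormedType.Exports.

Local Open Scope classical_set_scope.
Local Open Scope ring_scope.

Variant scalars := RealScalars | ComplexScalars.

Definition scalar_field (R : realType) (k : scalars) : numFieldType :=
  match k with
  | RealScalars => R
  | ComplexScalars => R[i]
  end.

Definition scalar_re (R : realType) (k : scalars) : scalar_field R k -> R :=
  match k return scalar_field R k -> R with
  | RealScalars => fun z => z
  | ComplexScalars => fun z : R[i] => complex.Re z
  end.

Definition of_real (R : realType) (k : scalars) : R -> scalar_field R k :=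
  match k return R -> scalar_field R k with
  | RealScalars => fun r => r
  | ComplexScalars => fun r => (r%:C)%C
  end.
Arguments of_real {R} k.

Section ScalarTheory.
Context (R : realType) (k : scalars).
Implicit Types (a b : scalar_field R k) (r s : R).

Lemma of_realK r : scalar_re (of_real k r) = r.
Proof. by case: k. Qed.

Lemma scalar_reK a : 0 <= a -> of_real k (scalar_re a) = a.
Proof.
case: k a => //= a; rewrite lecE /= => /andP[/eqP a0 _].
by case: a a0 => [x y] /= ->.
Qed.

Lemma of_realD r s : of_real k (r + s) = of_real k r + of_real k s.
Proof. by case: k => //=; exact: rmorphD. Qed.

Lemma of_realM r s : of_real k (r * s) = of_real k r * of_real k s.
Proof. by case: k => //=; exact: rmorphM. Qed.

Lemma of_real0 : of_real k 0 = 0 :> scalar_field R k.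
Proof. by case: k. Qed.

Lemma of_real1 : of_real k 1 = 1 :> scalar_field R k.
Proof. by case: k. Qed.

Lemma ler_of_real r s : (of_real k r <= of_real k s) = (r <= s).
Proof. by case: k => //=; rewrite lecR. Qed.

Lemma ltr_of_real r s : (of_real k r < of_real k s) = (r < s).
Proof. by case: k => //=; rewrite ltcR. Qed.

Lemma scalar_re_le a b : a <= b -> scalar_re a <= scalar_re b.
Proof. by case: k a b => //= a b; rewrite lecE => /andP[]. Qed.

End ScalarTheory.

(* The library norm of a normed space takes its values in the scalar field, as
   nonnegative elements; [rnorm] is the same number seen in [R]. *)
Definition rnorm (R : realType) (k : scalars)
  (X : normedModType (scalar_field R k)) (x : X) : R := scalar_re `|x|.

Section RnormTheory.
Context (R : realType) (k : scalars) (X : normedModType (scalar_field R k)).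

Lemma of_real_rnorm (x : X) : of_real k (rnorm x) = `|x|.
Proof. exact: scalar_reK. Qed.

Lemma rnorm_ge0 (x : X) : 0 <= rnorm x.
Proof. by rewrite -(ler_of_real k) of_real_rnorm of_real0. Qed.

Lemma rnormD (x y : X) : rnorm (x + y) <= rnorm x + rnorm y.
Proof.
by rewrite -(ler_of_real k) of_realD !of_real_rnorm ler_normD.
Qed.

Lemma rnormB (x y : X) : `|rnorm x - rnorm y| <= rnorm (x - y).
Proof.
rewrite ler_norml lerBlDr lerNl opprB lerBlDr; apply/andP; split.
  have -> : rnorm (x - y) = rnorm (y - x) by rewrite /rnorm distrC.
  by have := rnormD (y - x) x; rewrite subrK.
by have := rnormD (x - y) y; rewrite subrK.
Qed.

Lemma rnorm_continuous : continuous (@rnorm R k X).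
Proof.
move=> x; apply/cvgrPdist_lt => eps e0.
have ke0 : 0 < of_real k eps by rewrite -of_real0 ltr_of_real.
have /cvgrPdist_lt/(_ _ ke0) := @cvg_id _ (nbhs x).
apply: filterS => y; rewrite -of_real_rnorm ltr_of_real.
exact/le_lt_trans/rnormB.
Qed.

End RnormTheory.

Section C0_space.
Context (R : realType) (k : scalars) (L : topologicalType).
Local Notation K := (scalar_field R k).

Definition vanishes_at_infinity (E : normedModType K) (f : L -> E) :=
  forall eps : K, 0 < eps -> compact [set t | eps <= `|f t|].

Context (E : completeNormedModType K).

Definition C0_pred : {pred L -> E} :=
  [pred f | `[< continuous (f : L -> E) /\ vanishes_at_infinity f >]].

Record C0 := MkC0 { C0_fun :> L -> E ; C0_funP : C0_fun \in C0_pred }.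

HB.instance Definition _ := [isSub for C0_fun].
HB.instance Definition _ := [Choice of C0 by <:].

Lemma C0_predP (f : L -> E) :
  reflect (continuous f /\ vanishes_at_infinity f) (f \in C0_pred).
Proof. exact: asboolP. Qed.

Lemma C0_continuous (f : C0) : continuous f.
Proof. by case/C0_predP: (C0_funP f). Qed.

Lemma C0_vanishes (f : C0) : vanishes_at_infinity f.
Proof. by case/C0_predP: (C0_funP f). Qed.

Lemma closed_norm_ge (f : L -> E) (eps : K) :
  continuous f -> 0 < eps -> closed [set t | eps <= `|f t|].
Proof.
move=> cf e0; rewrite -[X in closed X]setCK; apply: open_closedC.
rewrite openE => t /= /negP ft.
have {}ft : `|f t| < eps by rewrite real_ltNge ?normr_real// gtr0_real.
have d0 : 0 < eps - `|f t| by rewrite subr_gt0.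
have /cvgrPdist_lt/(_ _ d0) := cf t.
apply: filterS => s fs /=; apply/negP.
rewrite -real_ltNge ?normr_real ?gtr0_real//.
rewrite -(subrK (f t) (f s)) (le_lt_trans (ler_normD _ _))//.
by rewrite distrC -ltrBrDr.
Qed.

Lemma C0_submod_closed : submod_closed C0_pred.
Proof.
split.
  apply/C0_predP; split; first by move=> t; exact: cvg_cst.
  move=> eps e0; rewrite [X in compact X](_ : _ = set0); first exact: compact0.
  apply/seteqP; split => // t /=.
  by rewrite normr0 (lt_geF e0).
move=> a f g /C0_predP[cf vf] /C0_predP[cg vg]; apply/C0_predP.
have cfg : continuous (a *: f + g).
  by move=> t; apply: cvgD; [apply: cvgZr; exact: cf|exact: cg].
split=> // eps e0.
have a1 : 0 < `|a| + 1 by rewrite ltr_pwDr.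
have e2 : 0 < eps / 2 by rewrite divr_gt0.
have e3 : 0 < eps / 2 / (`|a| + 1) by rewrite divr_gt0.
apply: subclosed_compact (compactU (vf _ e3) (vg _ e2)) _.
  exact: closed_norm_ge.
move=> t /= et; case: (real_leP (gtr0_real e2) (normr_real (g t))).
  by right.
move=> gt; left; rewrite /= real_leNgt ?normr_real ?gtr0_real//; apply/negP.
rewrite ltr_pdivlMr// => ft.
suff : `|(a *: f + g) t| < eps.
  by rewrite real_ltNge ?normr_real ?gtr0_real// et.
rewrite (le_lt_trans (ler_normD _ _))// [eps]splitr ltrD//.
rewrite normrZ (le_lt_trans _ ft)// mulrDr mulr1 mulrC lerDl.
exact: normr_ge0.
Qed.

HB.instance Definition _ :=
  GRing.isSubmodClosed.Build K (L -> E) C0_pred C0_submod_closed.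
HB.instance Definition _ := [SubChoice_isSubLmodule of C0 by <:].

Lemma C0P (f g : C0) : f =1 g -> f = g.
Proof. by move=> fg; apply/val_inj/funext. Qed.

Lemma C0D (f g : C0) t : (f + g) t = f t + g t. Proof. by []. Qed.
Lemma C0Z a (f : C0) t : (a *: f) t = a *: f t. Proof. by []. Qed.
Lemma C0N (f : C0) t : (- f) t = - f t. Proof. by []. Qed.

Definition C0_norm (f : C0) : R := sup (range (fun t => rnorm (f t))).

Lemma C0_has_ubound (f : C0) : has_ubound (range (fun t => rnorm (f t))).
Proof.
have cf : continuous (fun t => rnorm (f t)).
  by move=> t; apply: continuous_comp; [exact: C0_continuous|exact: rnorm_continuous].
have /continuous_compact : {within [set t | 1 <= `|f t|],
    continuous (fun t => rnorm (f t))} by exact/continuous_subspaceT.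
move=> /(_ (C0_vanishes (f := f) ltr01))/compact_bounded[M [_ fM]].
have M1 : M < `|M| + 1 by rewrite (le_lt_trans (ler_norm M))// ltrDl.
exists (`|M| + 1) => _ [t _ <-].
have [f1|f1] := real_leP (real1 K) (normr_real (f t)).
  by rewrite (le_trans (ler_norm _))//; apply: fM M1 _ _; exists t.
have : rnorm (f t) < 1.
  by rewrite -(ltr_of_real k) of_real_rnorm of_real1.
by move=> /ltW/le_trans; apply; rewrite lerDr.
Qed.

Lemma C0_norm_ge (f : C0) t : rnorm (f t) <= C0_norm f.
Proof. by apply: ub_le_sup; [exact: C0_has_ubound|exists t]. Qed.

Lemma C0_norm_le (f : C0) M :
  0 <= M -> (forall t, rnorm (f t) <= M) -> C0_norm f <= M.
Proof.
move=> M0 fM; rewrite /C0_norm; set A := (X in sup X).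
have [->|A0] := eqVneq A set0; first by rewrite sup0.
by apply: ge_sup; [exact/set0P|move=> _ [t _ <-]].
Qed.

Lemma C0_norm_ge0 (f : C0) : 0 <= C0_norm f.
Proof.
rewrite /C0_norm; set A := (X in sup X).
have [->|/set0P[_ [t _ _]]] := eqVneq A set0; first by rewrite sup0.
by apply: le_trans (C0_norm_ge f t); exact: rnorm_ge0.
Qed.

Definition C0_normK (f : C0) : K := of_real k (C0_norm f).

Lemma C0_normKD (f g : C0) : C0_normK (f + g) <= C0_normK f + C0_normK g.
Proof.
rewrite /C0_normK -of_realD ler_of_real; apply: C0_norm_le.
  by rewrite addr_ge0 ?C0_norm_ge0.
move=> t; rewrite C0D (le_trans (rnormD _ _))//.
by rewrite lerD ?C0_norm_ge.
Qed.

Lemma C0_normKZ (a : K) (f : C0) : C0_normK (a *: f) = `|a| * C0_normK f.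
Proof.
have leZ b h : C0_normK (b *: h) <= `|b| * C0_normK h.
  have b0 : 0 <= scalar_re `|b|.
    by rewrite -(ler_of_real k) scalar_reK// of_real0.
  rewrite -[`|b|]scalar_reK// /C0_normK -of_realM ler_of_real.
  apply: C0_norm_le; first by rewrite mulr_ge0 ?C0_norm_ge0.
  move=> t; rewrite -(ler_of_real k) of_realM of_real_rnorm C0Z normrZ.
  rewrite scalar_reK// ler_wpM2l// -of_real_rnorm ler_of_real.
  exact: C0_norm_ge.
apply/le_anti/andP; split; first exact: leZ.
have [->|a0] := eqVneq a 0.
  by rewrite normr0 mul0r -of_real0 ler_of_real C0_norm_ge0.
rewrite -[in leLHS](scale1r f) -(mulVf a0) -scalerA.
rewrite (le_trans (ler_wpM2l _ (leZ a^-1 (a *: f))))//.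
by rewrite mulrA -normrM divff// normr1 mul1r.
Qed.

Lemma C0_normK_eq0 (f : C0) : C0_normK f = 0 -> f = 0.
Proof.
move=> f0; apply: C0P => t; apply/normr0_eq0/le_anti; rewrite normr_ge0 andbT.
by rewrite -f0 -of_real_rnorm ler_of_real C0_norm_ge.
Qed.

HB.instance Definition _ :=
  Lmodule_isNormed.Build K C0 C0_normKD C0_normKZ C0_normK_eq0.

Lemma C0_normE (f : C0) : `|f| = of_real k (C0_norm f).
Proof. by []. Qed.

Lemma C0_le_norm (f : C0) t : `|f t| <= `|f|.
Proof. by rewrite C0_normE -of_real_rnorm ler_of_real C0_norm_ge. Qed.

Lemma C0_norm_le_of (f : C0) (M : K) :
  0 <= M -> (forall t, `|f t| <= M) -> `|f| <= M.
Proof.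
move=> M0 fM; rewrite C0_normE -[M]scalar_reK// ler_of_real.
apply: C0_norm_le => [|t]; last exact: scalar_re_le.
by rewrite -(ler_of_real k) scalar_reK// of_real0.
Qed.

Lemma C0_complete (F : set_system C0) : ProperFilter F -> cauchy F -> cvg F.
Proof.
move=> FF /cauchyP Fc.
have cvgF t : cvg ((fun f : C0 => f t) @ F).
  apply: cauchy_cvg; apply/cauchyP => eps e0; have [f Ff] := Fc _ e0.
  exists (f t); rewrite /fmap /=; apply: filterS Ff => h.
  by rewrite -!ball_normE /=; apply: le_lt_trans; exact: (C0_le_norm (f - h)).
pose g t := lim ((fun f : C0 => f t) @ F).
have approx eps : 0 < eps ->
    exists f0 : C0, F (ball f0 eps) /\ forall t, `|g t - f0 t| < eps.
  move=> e0; have e2 : 0 < eps / 2 by rewrite divr_gt0.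
  have [f0 Ff0] := Fc _ e2; exists f0; split.
    by apply: filterS Ff0; apply: le_ball; rewrite ler_pdivrMr// ler_pMr// ler1n.
  move=> t; have /cvgrPdist_lt/(_ _ e2) Fg := cvgF t.
  have [h []] := filter_ex (filterI Ff0 Fg).
  rewrite -ball_normE /= => f0h gh; rewrite -(subrK (h t) (g t)) -addrA.
  rewrite (le_lt_trans (ler_normD _ _))// [eps]splitr ltrD//.
  by rewrite distrC; apply: le_lt_trans f0h; exact: (C0_le_norm (f0 - h)).
have cg : continuous g.
  move=> t; apply/cvgrPdist_lt => eps e0.
  have e2 : 0 < eps / 2 by rewrite divr_gt0.
  have e4 : 0 < eps / 2 / 2 by rewrite divr_gt0.
  have [f0 [_ gf0]] := approx _ e4.
  have /(_ t)/cvgrPdist_lt/(_ _ e2) := @C0_continuous f0.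
  apply: filterS => s f0s.
  have -> : g t - g s = (g t - f0 t) + (f0 t - f0 s) + (f0 s - g s).
    by rewrite !subrKA.
  rewrite (le_lt_trans (ler_normD _ _))//.
  rewrite (_ : eps = eps / 2 / 2 + eps / 2 + eps / 2 / 2); last first.
    by rewrite addrAC -splitr -splitr.
  rewrite ltrD//; last by rewrite distrC.
  by rewrite (le_lt_trans (ler_normD _ _))// ltrD.
have vg : vanishes_at_infinity g.
  move=> eps e0; have e2 : 0 < eps / 2 by rewrite divr_gt0.
  have [f0 [_ gf0]] := approx _ e2.
  apply: subclosed_compact (C0_vanishes (f := f0) e2) _; first exact: closed_norm_ge.
  move=> t /= et; rewrite real_leNgt ?normr_real ?gtr0_real//.
  apply/negP => ft; suff : `|g t| < eps.
    by rewrite real_ltNge ?normr_real ?gtr0_real// et.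
  rewrite -(subrK (f0 t) (g t)) (le_lt_trans (ler_normD _ _))//.
  by rewrite [eps]splitr ltrD.
have gP : g \in C0_pred by apply/C0_predP.
apply/cvg_ex; exists (MkC0 gP); apply/cvgrPdist_lt => eps e0.
have e2 : 0 < eps / 2 by rewrite divr_gt0.
have [f0 [Ff0 gf0]] := approx _ e2.
apply: filterS Ff0 => h; rewrite -ball_normE /= => f0h.
rewrite -(subrK f0 (MkC0 gP)) -addrA (le_lt_trans (ler_normD _ _))//.
rewrite [eps]splitr ler_ltD//; apply: C0_norm_le_of; first exact: ltW.
by move=> t; apply/ltW/gf0.
Qed.

HB.instance Definition _ := Uniform_isComplete.Build C0 C0_complete.

End C0_space.

Section BPB_modulus.
Context (R : realType) (k : scalars).
Context (X : completeNormedModType (scalar_field R k)).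
Local Notation K := (scalar_field R k).

Record dual := MkDual {
  dual_fun :> {linear X -> K^o} ;
  dual_continuous : continuous dual_fun }.

(* The operator norm.  The real supremum [sup] is junk on unbounded sets, but
   [dual_norm] is only applied to continuous functionals, which are bounded on
   the unit ball. *)
Definition dual_norm (f : X -> K^o) : R :=
  sup [set rnorm (f x) | x in [set x : X | rnorm x <= 1]].

Definition unit_ball : set X := [set x | rnorm x <= 1].
Definition unit_sphere : set X := [set x | rnorm x = 1].
Definition dual_unit_ball : set dual := [set f : dual | dual_norm f <= 1].
Definition dual_unit_sphere : set dual := [set f : dual | dual_norm f = 1].

Definition Pi_set : set (X * dual) :=
  [set p : X * dual | [/\ rnorm p.1 = 1, dual_norm p.2 = 1 & p.2 p.1 = 1]].

(* The infimum is genuine when [X] is nonzero: every [eps > 2] then belongs to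
   the set, as [Pi_set] is nonempty by Hahn-Banach. *)
Definition BPB_modulus_on (A : set X) (B : set dual) (delta : R) : R :=
  inf [set eps : R | 0 < eps /\
    forall (x : X) (f : dual), A x -> B f -> 1 - delta < scalar_re (f x) ->
    exists (y : X) (g : dual),
      [/\ Pi_set (y, g), rnorm (x - y) < eps & dual_norm (f \- g) < eps]].

Definition BPB_modulus : R -> R := BPB_modulus_on unit_ball dual_unit_ball.

Definition spherical_BPB_modulus : R -> R :=
  BPB_modulus_on unit_sphere dual_unit_sphere.

End BPB_modulus.

(* Main.v *)
(** Upper bound, valid in every Banach space.  For (x, f) in the two unit
    balls with Re f(x) > 1 - delta, put s = sqrt (2 delta) and b = 1 - |f|.
    Ekeland's principle followed by a Hahn-Banach separation (Phelps) gives,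
    for each c > 0, a point y of the unit ball and a functional h attaining its
    norm at y with |f - h| <= c and c |x - y| <= |f| - Re f(x) < delta - b.
    Replacing h by h / |h| costs at most b + c, and the choice c = (s - b) / 2
    bounds both distances by s.

    Lower bound.  Fix two points s, t of L, a unit vector e with a norming
    functional e', and 0 < eps <= 1.  Take x = phi e with phi(s) = 1 and
    phi(t) = 1 - eps, and f(z) = (1 - eps/2) e'(z(s)) + (eps/2) e'(z(t)), so
    that f(x) = 1 - eps^2/2.  If (y, g) is in Pi and |x - y| < eps then
    |y(t)| < 1, so g vanishes on functions supported near t.  For a bump psi at
    t, the function u = psi e - (1 - psi) y lies in the unit ball, g(u) = -1
    and Re f(u) >= -1 + eps; hence |f - g| >= eps. *)

From HB Require Import structures.
Require Import Defs.
From mathcomp Require Import all_boot all_order all_algebra.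
From mathcomp Require Import all_classical all_reals all_analysis.
From mathcomp Require Import complex ring lra.

Set Implicit Arguments.
Unset Strict Implicit.
Unset Printing Implicit Defensive.

Import Order.TTheory GRing.Theory Num.Theory.
Import numFieldNormedType.Exports.

Local Open Scope classical_set_scope.
Local Open Scope ring_scope.

(** * The Hahn-Banach sandwich theorem *)

Lemma le_inf_add (R : realType) (A B : set R) (x : R) : A !=set0 -> B !=set0 ->
  (forall a b, A a -> B b -> x <= a + b) -> x <= inf A + inf B.
Proof.
move=> A0 B0 xAB; rewrite -lerBlDl; apply: lb_le_inf => // b Bb.
rewrite lerBlDl -lerBlDr; apply: lb_le_inf => // a Aa.
by rewrite lerBlDr; exact: xAB.
Qed.

Lemma le_inf_mul (R : realType) (A : set R) (r x : R) : A !=set0 -> 0 <= r ->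
  (forall a, A a -> x <= r * a) -> x <= r * inf A.
Proof.
move=> A0; rewrite le_eqVlt => /predU1P[<-|r0] xA.
  by have [a /xA] := A0; rewrite !mul0r.
rewrite -ler_pdivrMl//; apply: lb_le_inf => // a Aa.
by rewrite ler_pdivrMl//; exact: xA.
Qed.

Section HahnBanach.
Context (R : realType) (V : lmodType R).
Implicit Types (p q : V -> R) (C : set V).

(** One inequality is enough for homogeneity: the inverse scalar gives the reverse one for [r > 0],
    and [r = 0] gives [p 0 <= 0]. *)
Definition sublinear p :=
  (forall u v, p (u + v) <= p u + p v) /\
  (forall r v, 0 <= r -> p (r *: v) <= r * p v).

Definition convex_cone C :=
  [/\ C 0, forall u v, C u -> C v -> C (u + v) &
      forall r v, 0 <= r -> C v -> C (r *: v)].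

Definition superlinear_on C q :=
  (forall u v, C u -> C v -> q u + q v <= q (u + v)) /\
  (forall r v, 0 <= r -> C v -> r * q v <= q (r *: v)).

Lemma sublinear_ge0 p v : sublinear p -> 0 <= p v + p (- v).
Proof.
move=> [pD pM]; have := pD v (- v); rewrite subrr; apply: le_trans.
by have := pD 0 0; rewrite addr0 -lerBlDl subrr.
Qed.

(* The infimal convolution below is the common engine: it drives a minimal
   sublinear functional to be linear, and it forces domination on a cone. *)
Definition cone_reduction p C q v := inf [set p (v + c) - q c | c in C].

Section ConeReduction.
Context (p : V -> R) (C : set V) (q : V -> R).
Context (plin : sublinear p) (Ccone : convex_cone C).
Context (qlin : superlinear_on C q) (qp : forall c, C c -> q c <= p c).

Let img v := [set p (v + c) - q c | c in C].

Let img_neq0 v : img v !=set0.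
Proof. by case: Ccone => C0 _ _; exists (p (v + 0) - q 0), 0. Qed.

Let img_lb v : has_lbound (img v).
Proof.
exists (- p (- v)) => _ [c Cc <-].
have [pD _] := plin; have := pD (v + c) (- v); rewrite addrAC subrr add0r.
by have := qp Cc; lra.
Qed.

Lemma cone_reduction_le v c : C c -> cone_reduction p C q v <= p (v + c) - q c.
Proof. by move=> Cc; apply: ge_inf; [exact: img_lb|exists c]. Qed.

Lemma cone_reduction_sublinear : sublinear (cone_reduction p C q).
Proof.
have [[pD pM] [C0 CD CM] [qD qM]] := And3 plin Ccone qlin; split=> [u v|r v r0].
  apply: le_inf_add => [||_ _ [c Cc <-] [d Cd <-]]; [exact: img_neq0..|].
  apply: le_trans (cone_reduction_le _ (CD _ _ Cc Cd)) _.
  rewrite addrACA; have := pD (u + c) (v + d); have := qD _ _ Cc Cd; lra.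
apply: le_inf_mul => [||_ [c Cc <-]]; [exact: img_neq0|by []|].
apply: le_trans (cone_reduction_le _ (CM _ _ r0 Cc)) _.
by rewrite -scalerDr mulrBr lerB// ?pM ?qM.
Qed.

Lemma cone_reduction_le_self v : cone_reduction p C q v <= p v.
Proof.
have [C0 _ _] := Ccone; apply: le_trans (cone_reduction_le _ C0) _.
rewrite addr0 gerBl; have [_ qM] := qlin.
by have := qM 0 0 (lexx _) C0; rewrite mul0r scaler0.
Qed.

(** Domination on the cone comes from here: a linear [h] below the reduction satisfies
    [- h c = h (- c) <= - q c]. *)
Lemma cone_reduction_opp c : C c -> cone_reduction p C q (- c) <= - q c.
Proof.
move=> Cc; apply: le_trans (cone_reduction_le _ Cc) _.
rewrite addNr gerDr; have [_ pM] := plin.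
by have := pM 0 0 (lexx _); rewrite mul0r scaler0.
Qed.

End ConeReduction.

Definition ray (v : V) : set V := [set t *: v | t in [set t : R | 0 <= t]].

Lemma convex_cone_ray v : convex_cone (ray v).
Proof.
split=> [|_ _ [r r0 <-] [s s0 <-]|r _ r0 [s s0 <-]].
- by exists 0; [exact: lexx|rewrite scale0r].
- by exists (r + s); [exact: addr_ge0|rewrite scalerDl].
- by exists (r * s); [exact: mulr_ge0|rewrite scalerA].
Qed.

(** Reducing [p] along the ray through [w], with [q = p], gives a sublinear functional below [p],
    hence equal to [p] by minimality. Its value at [u] is at most [p (u + w) - p w], so [p] is also
    superadditive. *)
Lemma minimal_sublinear_linear p : sublinear p ->
  (forall p', sublinear p' -> (forall v, p' v <= p v) ->
     forall v, p v <= p' v) ->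
  scalar p.
Proof.
move=> plin pmin; have [pD pM] := plin.
have p0 : p 0 = 0.
  apply/le_anti; have := pM 0 0 (lexx _); rewrite mul0r scaler0 => ->/=.
  by have := sublinear_ge0 0 plin; rewrite oppr0; lra.
have hom t v : 0 <= t -> p (t *: v) = t * p v.
  rewrite le_eqVlt => /predU1P[<-|t0]; first by rewrite scale0r mul0r p0.
  apply/le_anti; rewrite pM ?(ltW t0)//= -ler_pdivlMl//.
  have := pM t^-1 (t *: v); rewrite scalerA mulVf ?gt_eqF// scale1r.
  by apply; rewrite invr_ge0 ltW.
have super u w : p u + p w <= p (u + w).
  have qlin : superlinear_on (ray w) p.
    split=> [_ _ [r r0 <-] [s s0 <-]|r _ r0 [s s0 <-]].
      by rewrite -scalerDl !hom ?addr_ge0// mulrDl.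
    by rewrite (hom r).
  have le c : ray w c -> p c <= p c by [].
  have := pmin _ (cone_reduction_sublinear plin (convex_cone_ray w) qlin le)
    (cone_reduction_le_self plin (convex_cone_ray w) qlin le) u.
  have rw : ray w w by exists 1; [exact: ler01|rewrite scale1r].
  by move=> /le_trans/(_ (cone_reduction_le plin le u rw)); lra.
have add u w : p (u + w) = p u + p w by apply/le_anti; rewrite pD super.
have opp u : p (- u) = - p u.
  by apply/eqP; rewrite -addr_eq0 addrC -add subrr p0.
move=> t u w; rewrite add; congr (_ + _).
have [t0|/ltW t0] := leP 0 t; first exact: hom.
have := hom (- t) u; rewrite scaleNr opp oppr_ge0 mulNr => /(_ t0).
by move=> /oppr_inj.
Qed.

(** Zorn's lemma on the sublinear functionals below [p], with smaller functionals higher in the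
    order. The pointwise infimum of a chain is finite because [- p (- v)] bounds it below. *)
Lemma hahn_banach_minimal p : sublinear p ->
  exists2 h : V -> R, scalar h & forall v, h v <= p v.
Proof.
move=> plin.
pose T := {p' : V -> R | sublinear p' /\ forall v, p' v <= p v}.
pose le (a b : T) := `[< forall v, sval b v <= sval a v >].
have t0 : T by exists p; split.
have [||A Atot|m mmin] := @ZL_preorder T t0 le.
- by move=> a; apply/asboolP.
- move=> a b c /asboolP ba /asboolP cb; apply/asboolP => v.
  exact: le_trans (cb v) (ba v).
- have [->|/set0P[a0 Aa0]] := eqVneq A set0; first by exists t0.
  pose S v := [set sval a v | a in A].
  have S0 v : S v !=set0 by exists (sval a0 v), a0.
  have lb v : has_lbound (S v).
    exists (- p (- v)) => _ [a Aa <-]; have [alin ap] := svalP a.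
    by have := sublinear_ge0 v alin; have := ap (- v); lra.
  have leS v a : A a -> inf (S v) <= sval a v.
    by move=> Aa; apply: ge_inf => //; exists a.
  have qlin : sublinear (fun v => inf (S v)).
    split=> [u v|r v r0].
      apply: le_inf_add => // _ _ [a Aa <-] [b Ab <-].
      (* The smaller of the two chain members bounds both terms, so its own subadditivity
         suffices. *)
      have [/asboolP ab|/asboolP ba] := Atot a b Aa Ab.
        apply: le_trans (leS _ _ Ab) _; have [[bD _] _] := svalP b.
        by apply: le_trans (bD u v) _; rewrite lerD2r.
      apply: le_trans (leS _ _ Aa) _; have [[aD _] _] := svalP a.
      by apply: le_trans (aD u v) _; rewrite lerD2l.
    apply: le_inf_mul => // _ [a Aa <-]; apply: le_trans (leS _ _ Aa) _.
    by have [[_ aM] _] := svalP a; exact: aM.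
  have qp v : inf (S v) <= p v.
    by apply: le_trans (leS v _ Aa0) _; have [_] := svalP a0; exact.
  exists (exist _ (fun v => inf (S v)) (conj qlin qp)) => a Aa.
  by apply/asboolP => v; exact: leS.
have [mlin mp] := svalP m; exists (sval m) => //.
apply: minimal_sublinear_linear => // p' p'lin p'm.
have p'p v : p' v <= p v := le_trans (p'm v) (mp v).
have /asboolP := mmin (exist _ p' (conj p'lin p'p)) (asboolT p'm).
exact.
Qed.

Theorem sandwich p C q : sublinear p -> convex_cone C ->
    superlinear_on C q -> (forall c, C c -> q c <= p c) ->
  exists h : V -> R,
    [/\ scalar h, forall v, h v <= p v & forall c, C c -> q c <= h c].
Proof.
move=> plin Ccone qlin qp.
have [h hlin hp] := hahn_banach_minimal (cone_reduction_sublinear plin Ccone qlin qp).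
exists h; split=> // [v|c Cc].
  exact: le_trans (hp v) (cone_reduction_le_self plin Ccone qlin qp v).
rewrite -lerN2 (_ : - h c = h (- c)).
  exact: le_trans (hp _) (cone_reduction_opp plin qp Cc).
have := hlin (-1) c 0; have := hlin 1 0 0; rewrite !addr0 scale1r mul1r scaleN1r.
by lra.
Qed.

End HahnBanach.

(** * Real parts, norms and continuous functionals *)

Section ScalarRe.
Context (R : realType) (k : scalars).
Local Notation K := (scalar_field R k).
Implicit Types (a b : K) (r : R).

Lemma scalar_reD a b : scalar_re (a + b) = scalar_re a + scalar_re b.
Proof. by case: k a b => //= -[? ?] [? ?]. Qed.

Lemma scalar_reN a : scalar_re (- a) = - scalar_re a.
Proof. by case: k a => //= -[? ?]. Qed.

Lemma scalar_reB a b : scalar_re (a - b) = scalar_re a - scalar_re b.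
Proof. by rewrite scalar_reD scalar_reN. Qed.

Lemma scalar_reZ r a : scalar_re (of_real k r * a) = r * scalar_re a.
Proof. by case: k a => //= -[? ?] /=; rewrite mul0r subr0. Qed.

Lemma of_real_neq0 r : r != 0 -> of_real k r != 0.
Proof. by case: k => //= r0; rewrite eq_complex /= (negPf r0). Qed.

Lemma of_realN r : of_real k (- r) = - of_real k r.
Proof. by case: k => //=; exact: rmorphN. Qed.

Lemma of_real_ge0 r : (0 <= of_real k r) = (0 <= r).
Proof. by rewrite -(of_real0 R k) ler_of_real. Qed.

Lemma rnorm_of_real r : rnorm (of_real k r : K^o) = `|r|.
Proof.
have [r0|r0] := leP 0 r; rewrite /rnorm.
  by rewrite [`|of_real k r|]ger0_norm ?of_realK ?of_real_ge0// ger0_norm.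
rewrite -[`|of_real k r|]normrN -of_realN [`|of_real _ _|]ger0_norm.
  by rewrite of_realK ltr0_norm.
by rewrite of_real_ge0 oppr_ge0 ltW.
Qed.

Lemma scalar_re_le_rnorm (a : K^o) : scalar_re a <= rnorm a.
Proof.
rewrite /rnorm; case: k a => /= a; first exact: ler_norm.
have := normc_ge_Re a; rewrite lecE /= => /andP[_]; exact/le_trans/ler_norm.
Qed.

(** Multiplying by such a phase turns estimates on real parts into estimates on absolute values. *)
Lemma scalar_rotation (a : K) :
  exists2 u : K^o, rnorm u = 1 & u * a = of_real k (rnorm (a : K^o)).
Proof.
have [->|a0] := eqVneq a 0.
  exists (of_real k 1); first by rewrite rnorm_of_real normr1.
  by rewrite mulr0 -(of_real0 R k) rnorm_of_real normr0.
exists (`|a| / a); last by rewrite of_real_rnorm divfK.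
rewrite /rnorm [`|_|]normrM normfV normr_id divff ?normr_eq0//.
by rewrite -(of_real1 R k) of_realK.
Qed.

End ScalarRe.

Section Rnorm.
Context (R : realType) (k : scalars) (X : normedModType (scalar_field R k)).
Local Notation K := (scalar_field R k).
Implicit Types (x y : X).

Lemma rnormZ (a : K) x : rnorm (a *: x) = rnorm (a : K^o) * rnorm x.
Proof.
by rewrite [LHS]/rnorm normrZ -[X in X * _](of_real_rnorm (a : K^o)) scalar_reZ.
Qed.

Lemma rnormN x : rnorm (- x) = rnorm x.
Proof. by rewrite /rnorm normrN. Qed.

Lemma rnorm_sym x y : rnorm (x - y) = rnorm (y - x).
Proof. by rewrite -rnormN opprB. Qed.

Lemma rnorm0 : rnorm (0 : X) = 0.
Proof. by rewrite /rnorm normr0 -(of_real0 R k) of_realK. Qed.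

Lemma rnorm0_eq0 x : rnorm x = 0 -> x = 0.
Proof.
by move=> x0; apply/normr0_eq0; rewrite -of_real_rnorm x0 of_real0.
Qed.

Lemma rnormZr r x : 0 <= r -> rnorm (of_real k r *: x) = r * rnorm x.
Proof. by move=> r0; rewrite rnormZ rnorm_of_real ger0_norm. Qed.

End Rnorm.

Section DualNorm.
Context (R : realType) (k : scalars) (X : completeNormedModType (scalar_field R k)).
Local Notation K := (scalar_field R k).
Implicit Types (f g : dual X) (x : X).

Lemma dual_norm_le (f : X -> K^o) (c : R) : 0 <= c ->
  (forall x, rnorm (f x) <= c * rnorm x) -> dual_norm f <= c.
Proof.
move=> c0 fc; apply: ge_sup => [|_ [x /= x1 <-]].
  by exists (rnorm (f 0)), 0 => //=; rewrite rnorm0.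
by apply: le_trans (fc x) _; rewrite ler_piMr.
Qed.

Lemma dual_norm_ge f x : rnorm x <= 1 -> rnorm (f x) <= dual_norm f.
Proof.
move=> x1; apply: ub_le_sup; last by exists x.
have /linear_bounded_continuous/linear_boundedP := @dual_continuous _ _ _ f.
move=> /pinfty_ex_gt0[M M0 fM]; exists (scalar_re M) => _ [y /= y1 <-].
rewrite -(ler_of_real k) of_real_rnorm (scalar_reK (ltW M0)).
apply: le_trans (fM y) _; rewrite ler_piMr ?(ltW M0)// -of_real_rnorm -(of_real1 R k).
by rewrite ler_of_real.
Qed.

Lemma dual_norm_ge0 f : 0 <= dual_norm f.
Proof.
by apply: le_trans (rnorm_ge0 (f 0)) _; apply: dual_norm_ge; rewrite rnorm0.
Qed.

Lemma dual_norm_bound f x : rnorm (f x) <= dual_norm f * rnorm x.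
Proof.
have [->|x0] := eqVneq x 0; first by rewrite linear0 !rnorm0 mulr0.
have nx0 : 0 < rnorm x.
  rewrite lt_neqAle rnorm_ge0 andbT eq_sym.
  by apply: contra_neq x0; exact: rnorm0_eq0.
rewrite -ler_pdivrMr// mulrC -rnormZr ?invr_ge0 ?(ltW nx0)//.
have -> : of_real k (rnorm x)^-1 *: f x = f (of_real k (rnorm x)^-1 *: x).
  by rewrite linearZ.
by apply: dual_norm_ge; rewrite rnormZr ?invr_ge0 ?(ltW nx0)// mulVf ?gt_eqF.
Qed.

Lemma dual_exists (g : X -> K) (c : R) :
    scalar g -> (forall x, rnorm (g x : K^o) <= c * rnorm x) ->
  exists g' : dual X, forall x, g' x = g x.
Proof.
move=> glin gc.
pose gL : {linear X -> K^o} :=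
  HB.pack (g : X -> K^o) (GRing.isLinear.Build K X K^o *:%R g glin).
have gC : continuous gL.
  apply/linear_bounded_continuous/linear_boundedP.
  exists (of_real k `|c|); split; first by rewrite ger0_real// of_real_ge0.
  move=> r cr x; have r0 : 0 <= r by rewrite (le_trans _ (ltW cr))// of_real_ge0.
  rewrite -!of_real_rnorm -(scalar_reK r0) -of_realM ler_of_real.
  apply: le_trans (gc x) _; rewrite ler_wpM2r ?rnorm_ge0//.
  by rewrite (le_trans (ler_norm c))// -(of_realK k `|c|) scalar_re_le// ltW.
by exists (MkDual gC).
Qed.

(** [dual] is a bare record without algebraic structure, so differences and multiples of functionals
    are produced through this statement. *)
Lemma dual_lin_exists (a : K) f g :
  exists d : dual X, forall x, d x = a * f x + g x.
Proof.
apply: (@dual_exists (fun x => a * f x + g x)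
  (rnorm (a : K^o) * dual_norm f + dual_norm g)) => [b x y|x].
  by rewrite !linearP /= /GRing.scale /=; ring.
rewrite mulrDl; apply: le_trans (rnormD _ _) _; rewrite lerD ?dual_norm_bound//.
by rewrite rnormZ -mulrA ler_wpM2l ?rnorm_ge0// dual_norm_bound.
Qed.

(** Rotating [x] so that [f x] becomes its absolute value does not change the norm of [x]. *)
Lemma scalar_bound (f : X -> K) (c : R) : scalar f ->
    (forall x, scalar_re (f x) <= c * rnorm x) ->
  forall x, rnorm (f x : K^o) <= c * rnorm x.
Proof.
move=> flin fc x; have [u u1 ufx] := scalar_rotation (f x).
have := fc (u *: x); rewrite rnormZ u1 mul1r; apply: le_trans.
have := flin u x 0; have := flin 1 0 0; rewrite !addr0 scale1r mul1r.
move=> /eqP; rewrite -subr_eq0 opprD addNKr oppr_eq0 => /eqP ->.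
by rewrite addr0 => ->; rewrite ufx of_realK.
Qed.

End DualNorm.

(** A separate name for [X], so that its module structure over [R] does not clash with the one over
    [scalar_field R k]. *)
Definition realification (R : realType) (k : scalars)
  (X : lmodType (scalar_field R k)) : Type := X.

Section Realification.
Context (R : realType) (k : scalars) (X : lmodType (scalar_field R k)).

HB.instance Definition _ := GRing.Zmodule.on (realification X).

Let scale (r : R) (x : realification X) : realification X := of_real k r *: (x : X).

Let scaleA a b v : scale a (scale b v) = scale (a * b) v.
Proof. by rewrite /scale scalerA of_realM. Qed.
Let scale1 : left_id 1 scale.
Proof. by move=> v; rewrite /scale of_real1 scale1r. Qed.
Let scaleDr : right_distributive scale +%R.
Proof. by move=> a u v; exact: scalerDr. Qed.
Let scaleDl v : {morph scale^~ v : a b / a + b}.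
Proof. by move=> a b; rewrite /scale of_realD; exact: scalerDl. Qed.

HB.instance Definition _ := GRing.Zmodule_isLmodule.Build R (realification X)
  scaleA scale1 scaleDr scaleDl.

End Realification.

Lemma realificationZ (R : realType) (k : scalars)
    (X : lmodType (scalar_field R k)) r (x : realification X) :
  r *: x = of_real k r *: (x : X).
Proof. by []. Qed.

(* Complex case: a real functional h is the real part of x |-> h x - i h (i x). *)
Lemma scalar_of_re (R : realType) (k : scalars)
    (X : lmodType (scalar_field R k)) (h : realification X -> R) : scalar h ->
  exists2 g : X -> scalar_field R k, scalar g & forall x, scalar_re (g x) = h x.
Proof.
case: k X h => X h hlin; first by exists h.
have hD u v : h (u + v) = h u + h v by have := hlin 1 u v; rewrite scale1r mul1r.
have h0 : h 0 = 0 by have := hD 0 0; rewrite addr0; lra.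
have hZ r u : h (r *: u) = r * h u by have := hlin r u 0; rewrite h0 !addr0.
pose I := (0 +i* 1)%C : R[i].
exists (fun x : X => (h x +i* - h (I *: x))%C) => // -[a b] u v.
(* Splitting a complex multiple of [w] into real multiples of [w] and [I *: w] reduces complex
   linearity to real linearity of [h]. *)
have E (a' b' : R) (w : X) :
    (a' +i* b')%C *: w = a' *: (w : realification X) + b' *: (I *: w : realification X).
  change ((a' +i* b')%C *: w = (a'%:C)%C *: w + (b'%:C)%C *: (I *: w) :> X).
  rewrite scalerA -scalerDl; congr (_ *: _).
  by apply/eqP; rewrite eq_complex /=; apply/andP; split; apply/eqP; ring.
have -> : I *: ((a +i* b)%C *: u + v) =
    (- b) *: (u : realification X) + a *: (I *: u : realification X) + I *: v.
  rewrite scalerDr; congr (_ + _); rewrite -E scalerA; congr (_ *: _).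
  by apply/eqP; rewrite eq_complex /=; apply/andP; split; apply/eqP; ring.
rewrite E !hD !hZ; apply/eqP; rewrite eq_complex /=.
by apply/andP; split; apply/eqP; ring.
Qed.

Lemma dual_of_re (R : realType) (k : scalars)
    (X : completeNormedModType (scalar_field R k)) (h : realification X -> R) c :
    0 <= c -> scalar h -> (forall x, h x <= c * rnorm (x : X)) ->
  exists g : dual X, (forall x, scalar_re (g x) = h x) /\ dual_norm g <= c.
Proof.
move=> c0 /scalar_of_re[g glin gh] hc.
have re_gc x : scalar_re (g x) <= c * rnorm x by rewrite gh.
have gc := scalar_bound glin re_gc.
have [g' g'E] := dual_exists glin gc; exists g'; split=> [x|].
  by rewrite g'E gh.
by apply: dual_norm_le => // x; rewrite g'E.
Qed.

(** * The upper bound, in an arbitrary Banach space *)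

(** Zorn's lemma for the order in which moving from [u] up to [v] raises [phi] by at least [c] times
    their distance. Since [phi] is bounded on [A], chains are Cauchy, and their limits are upper
    bounds; a maximal point above [x] is the one sought. *)
Lemma ekeland (R : realType) (k : scalars)
    (X : completeNormedModType (scalar_field R k)) (A : set X) (phi : X -> R)
    (c M : R) (x : X) :
    closed A -> continuous phi -> (forall z, A z -> phi z <= M) -> 0 < c -> A x ->
  exists x0, [/\ A x0, c * rnorm (x0 - x) <= phi x0 - phi x &
    forall z, A z -> phi z - phi x0 <= c * rnorm (z - x0)].
Proof.
move=> Acl phic phiM c0 Ax.
pose le (u v : X) := c * rnorm (v - u) <= phi v - phi u.
have lexx u : le u u by rewrite /le !subrr rnorm0 mulr0.
have le_tr u v w : le u v -> le v w -> le u w.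
  rewrite /le => uv vw; have := rnormD (w - v) (v - u); rewrite subrKA.
  by rewrite -(ler_pM2l c0) mulrDr; lra.
have clle u : closed [set v | le u v].
  have -> : [set v | le u v] =
      (fun v => phi v - phi u - c * rnorm (v - u)) @^-1` [set r | 0 <= r].
    by apply/seteqP; split=> v /=; rewrite /le subr_ge0.
  apply: preimage_closed; last exact: closed_ge.
  move=> v _; apply: cvgB; first by apply: cvgB; [exact: phic|exact: cvg_cst].
  apply: cvgM; first exact: cvg_cst.
  apply: (continuous_comp (f := fun v => v - u)); last exact: rnorm_continuous.
  by apply: cvgB; [exact: cvg_id|exact: cvg_cst].
pose T := {v : X | A v /\ le x v}.
have [||S Stot|m mmax] := @ZL_preorder T (exist _ x (conj Ax (lexx x)))
    (fun a b => le (sval a) (sval b)).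
- by move=> a; exact: lexx.
- by move=> a b d; exact: le_tr.
- have [->|/set0P[a0 Sa0]] := eqVneq S set0.
    by exists (exist _ x (conj Ax (lexx x))).
  (* The tails of the chain generate a filter, whose limit will be the upper bound. *)
  pose P (a : T) : set X := [set sval b | b in [set b | S b /\ le (sval a) (sval b)]].
  pose F := filter_from S P.
  have FF : ProperFilter F.
    apply: filter_from_proper; last first.
      by move=> a Sa; exists (sval a), a => //; split.
    apply: filter_from_filter; first by exists a0.
    move=> a b Sa Sb; have [ab|ba] := Stot a b Sa Sb.
      exists b => // _ [d [Sd bd] <-]; split; exists d => //; split=> //.
      exact: le_tr ab bd.
    exists a => // _ [d [Sd ad] <-]; split; exists d => //; split=> //.
    exact: le_tr ba ad.
  pose I := [set phi (sval a) | a in S].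
  have supI : has_sup I.
    split; first by exists (phi (sval a0)), a0.
    by exists M => _ [a _ <-]; apply: phiM; case: (svalP a).
  have FC : cauchy F.
    apply/cauchyP => eps eps0; pose e := scalar_re eps.
    have eK : of_real k e = eps by exact: scalar_reK (ltW eps0).
    have e0 : 0 < e by rewrite -(ltr_of_real k) eK of_real0.
    (* Once [phi] is within [c * e] of its supremum on the chain, all later points are within
       [e]. *)
    have [_ [a Sa <-] ma] := sup_adherent (mulr_gt0 c0 e0) supI.
    exists (sval a), a => // _ [b [Sb ab] <-].
    rewrite -ball_normE /= -eK -of_real_rnorm ltr_of_real rnorm_sym.
    rewrite -(ltr_pM2l c0); apply: le_lt_trans ab _.
    have : phi (sval b) <= sup I by apply: ub_le_sup; [case: supI|exists b].
    by move: ma; lra.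
  have Fl : F --> lim F by exact: cauchy_cvg.
  have inl (G : set X) a : closed G -> S a -> P a `<=` G -> G (lim F).
    move=> Gcl Sa PG; apply: (@closed_cvg _ _ F _ id G) => //.
    by exists a.
  have Al : A (lim F).
    by apply: (inl A a0 Acl Sa0) => _ [b _ <-]; case: (svalP b).
  have lel a : S a -> le (sval a) (lim F).
    by move=> Sa; apply: (inl _ a (clle (sval a)) Sa) => _ [b [_ ?] <-].
  have xl : le x (lim F).
    by apply: le_tr (lel _ Sa0); case: (svalP a0).
  by exists (exist _ (lim F) (conj Al xl)) => a Sa; exact: lel.
have [Am xm] := svalP m; exists (sval m); split=> // z Az.
have [//|mz] := leP (phi z - phi (sval m)) (c * rnorm (z - sval m)).
have := mmax (exist _ z (conj Az (le_tr _ _ _ xm (ltW mz)))) (ltW mz).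
rewrite /le /= (rnorm_sym (sval m)).
by have := mulr_ge0 (ltW c0) (rnorm_ge0 (z - sval m)); lra.
Qed.

(** * Phelps's perturbation argument and the Bishop-Phelps-Bollobas theorem *)

Section BishopPhelps.
Context (R : realType) (k : scalars) (X : completeNormedModType (scalar_field R k)).
Local Notation K := (scalar_field R k).

Lemma scalar_re_continuous (f : dual X) : continuous (fun x => scalar_re (f x)).
Proof.
move=> x; apply/cvgrPdist_le => e e0.
have ke0 : 0 < of_real k e by rewrite -(of_real0 R k) ltr_of_real.
have /cvgrPdist_le/(_ _ ke0) := @dual_continuous _ _ _ f x.
apply: filterS => y; rewrite -of_real_rnorm ler_of_real; apply: le_trans.
rewrite ler_norml -scalar_reB scalar_re_le_rnorm lerNl -scalar_reN.
by rewrite -(rnormN (_ - _)) scalar_re_le_rnorm.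
Qed.

Lemma closed_unit_ball : closed (@unit_ball R k X).
Proof.
apply: (@preimage_closed _ _ (@rnorm R k X) [set r | r <= 1]); last exact: closed_le.
by move=> x _; exact: rnorm_continuous.
Qed.

Lemma convex_unit_ball (u v : X) (r s : R) : 0 <= r -> 0 <= s -> r + s = 1 ->
  unit_ball u -> unit_ball v -> unit_ball (of_real k r *: u + of_real k s *: v).
Proof.
move=> r0 s0 rs u1 v1; rewrite /unit_ball /= (le_trans (rnormD _ _))//.
by rewrite !rnormZr// -rs lerD// ler_piMr.
Qed.

(* The cone generated by [unit_ball - x0] is where the perturbation of [f]
   found by [sandwich] has to dominate [f]. *)
Lemma phelps (f : dual X) (x : X) (c : R) : 0 < c -> unit_ball x ->
  exists (x0 : X) (g : dual X),
    [/\ unit_ball x0, c * rnorm (x - x0) <= scalar_re (f x0) - scalar_re (f x),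
        dual_norm (f \- g) <= c &
        forall z, unit_ball z -> scalar_re (g z) <= scalar_re (g x0)].
Proof.
move=> c0 Bx.
have fM z : unit_ball z -> scalar_re (f z) <= dual_norm f.
  by move=> z1; rewrite (le_trans (scalar_re_le_rnorm _))// dual_norm_ge.
have [x0 [Bx0 xx0 x0max]] :=
  ekeland closed_unit_ball (@scalar_re_continuous f) fM c0 Bx.
pose V := realification X.
pose C := [set v : V | exists t z,
  [/\ 0 <= t, unit_ball z & v = of_real k t *: (z - x0)]].
have Ccone : convex_cone C.
  split.
  - by exists 0, x0; split=> //; rewrite subrr scaler0.
  - move=> _ _ [r [y [r0 By ->]]] [s [z [s0 Bz ->]]].
    (* The sum is [r + s] times [w - x0], with [w] the weighted mean of [y] and [z]; the weights
       require [r + s] to be nonzero. *)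
    have [rs|rs] := eqVneq (r + s) 0.
      have -> : r = 0 by lra.
      have -> : s = 0 by lra.
      exists 0, x0; split=> //; rewrite !of_real0 !scale0r; exact: addr0.
    exists (r + s), (of_real k (r / (r + s)) *: y + of_real k (s / (r + s)) *: z).
    split; first exact: addr_ge0.
      by apply: convex_unit_ball => //; rewrite ?divr_ge0 ?addr_ge0// -mulrDl divff.
    rewrite [RHS]scalerBr [X in _ = X - _]scalerDr !scalerA -!of_realM.
    rewrite !(mulrC (r + s)) !divfK// of_realD scalerDl opprD !scalerBr.
    exact: addrACA.
  - move=> r _ r0 [s [z [s0 Bz ->]]]; exists (r * s), z; split=> //.
      exact: mulr_ge0.
    by rewrite realificationZ scalerA of_realM.
have plin : sublinear (fun v : V => c * rnorm (v : X)).
  split=> [u v|r v r0]; first by rewrite -mulrDr ler_wpM2l ?rnormD// ltW.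
  by rewrite realificationZ rnormZr// mulrCA.
have qlin : superlinear_on C (fun v : V => scalar_re (f (v : X))).
  split=> [u v _ _|r v r0 _].
    by rewrite -scalar_reD -linearD.
  by rewrite realificationZ linearZ scalar_reZ.
(* The hypothesis that [q] lies below [p] on the cone is exactly the Ekeland inequality at [x0]. *)
have [|h [hlin hc hC]] := sandwich plin Ccone qlin.
  move=> _ [t [z [t0 Bz ->]]]; rewrite linearZ scalar_reZ rnormZr// mulrCA.
  by rewrite ler_wpM2l// linearB scalar_reB x0max.
have [g [gE gc]] := dual_of_re (ltW c0) hlin hc.
(* The functional sought is [f - g]: as [g] dominates [f] in real part on the cone, the real part of
   [f - g] is maximal over the ball at [x0]. *)
have [d dE] := dual_lin_exists (-1) g f.
exists x0, d; split=> //.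
- by rewrite rnorm_sym.
- apply: dual_norm_le; first exact: ltW.
  move=> v; rewrite /= dE.
  have -> : f v - (-1 * g v + f v) = g v by ring.
  by apply: le_trans (dual_norm_bound _ _) _; rewrite ler_wpM2r ?rnorm_ge0.
move=> z Bz; rewrite !dE !mulN1r !scalar_reD !scalar_reN.
have /hC : C (z - x0) by exists 1, z; rewrite of_real1 scale1r.
by rewrite -gE !linearB !scalar_reB; lra.
Qed.

Lemma scalar_eq_of_real (a : K^o) : rnorm a <= scalar_re a ->
  a = of_real k (rnorm a).
Proof.
case: k a => [a aa|[x y]]; first by apply/le_anti; rewrite aa ler_norm.
have -> : rnorm ((x +i* y)%C : (scalar_field R ComplexScalars)^o) =
    Num.sqrt (x ^+ 2 + y ^+ 2) by exact: congr1 (normc_def _).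
move=> /= xy.
have x0 : 0 <= x by rewrite (le_trans _ xy)// sqrtr_ge0.
have y0 : y = 0.
  apply/eqP; rewrite -sqrf_eq0 -[_ == 0]andTb eq_le sqr_ge0 andbT.
  have : x ^+ 2 + y ^+ 2 <= x ^+ 2.
    rewrite -[leLHS]sqr_sqrtr ?addr_ge0 ?sqr_ge0//.
    by rewrite ler_sqr ?nnegrE ?sqrtr_ge0.
  by lra.
by rewrite y0 expr0n addr0 sqrtr_sqr ger0_norm.
Qed.

(** By rotation the supremum of Re g over the ball is |g|, so |g| <= Re g(y) <= |g(y)| <= |g| |y| <=
    |g| and equality holds throughout. *)
Lemma norm_attained (g : dual X) (y : X) : unit_ball y -> 0 < dual_norm g ->
    (forall z, unit_ball z -> scalar_re (g z) <= scalar_re (g y)) ->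
  rnorm y = 1 /\ g y = of_real k (dual_norm g).
Proof.
move=> y1 g0 gmax.
have ng : dual_norm g <= scalar_re (g y).
  apply: ge_sup => [|_ [z /= z1 <-]].
    by exists (rnorm (g 0)), 0 => //=; rewrite rnorm0.
  have [u u1 uz] := scalar_rotation (g z).
  have -> : rnorm (g z) = scalar_re (g (u *: z)).
    by rewrite linearZ /= [_ *: _]uz of_realK.
  by apply: gmax; rewrite /unit_ball /= rnormZ u1 mul1r.
have gy := dual_norm_bound g y; have re := scalar_re_le_rnorm (g y).
have y1' : rnorm y = 1.
  apply/le_anti; rewrite [rnorm y <= 1]y1 -(ler_pM2l g0) mulr1; lra.
split=> //; rewrite y1' mulr1 in gy; rewrite (@scalar_eq_of_real (g y)); last lra.
by congr of_real; lra.
Qed.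

Theorem bishop_phelps_bollobas (f : dual X) (x : X) (delta : R) :
    0 < delta -> delta <= 1 / 2 -> unit_ball x -> dual_unit_ball f ->
    1 - delta < scalar_re (f x) ->
  exists (y : X) (g : dual X), [/\ Pi_set (y, g),
    rnorm (x - y) <= Num.sqrt (2 * delta) &
    dual_norm (f \- g) <= Num.sqrt (2 * delta)].
Proof.
move=> d0 d2 Bx Bf fx; set s := Num.sqrt _; pose b := 1 - dual_norm f.
have s2 : s ^+ 2 = 2 * delta by rewrite sqr_sqrtr// mulr_ge0// ltW.
have s0 : 0 < s by rewrite sqrtr_gt0 mulr_gt0.
have s1 : s <= 1 by nra.
have b0 : 0 <= b by rewrite subr_ge0.
have fM z : unit_ball z -> scalar_re (f z) <= dual_norm f.
  by move=> z1; rewrite (le_trans (scalar_re_le_rnorm _))// dual_norm_ge.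
have bd : b < delta by have := fM _ Bx; rewrite /b; lra.
(* Chosen so that b + 2c = s. It is positive because s <= 1 gives b < delta < 2 delta = s^2 <= s. *)
pose c := (s - b) / 2.
have c0 : 0 < c by rewrite /c; nra.
have [y [h [By xy fh hmax]]] := phelps f c0 Bx.
have [d dE] := dual_lin_exists (-1) h f.
have fhd : dual_norm (f \- h) = dual_norm d.
  by congr dual_norm; apply/funext => z /=; rewrite dE mulN1r addrC.
have nh : `|dual_norm f - dual_norm h| <= c.
  rewrite ler_distl lerBlDr; apply/andP; split.
    apply: le_trans (_ : dual_norm f + dual_norm d <= _); last first.
      by rewrite -fhd lerD2l.
    apply: dual_norm_le; first by rewrite addr_ge0 ?dual_norm_ge0.
    move=> z; have -> : h z = f z - d z by rewrite dE; ring.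
    rewrite mulrDl (le_trans (rnormD _ _))// lerD ?dual_norm_bound//.
    by rewrite rnormN dual_norm_bound.
  apply: le_trans (_ : dual_norm h + dual_norm d <= _); last first.
    by rewrite -fhd lerD2l.
  apply: dual_norm_le; first by rewrite addr_ge0 ?dual_norm_ge0.
  move=> z; have -> : f z = h z + d z by rewrite dE; ring.
  by rewrite mulrDl (le_trans (rnormD _ _))// lerD ?dual_norm_bound.
move: nh; rewrite ler_distl => /andP[nh1 nh2].
(* |h| >= |f| - c = 1 - (s + b)/2, where s <= 1 and b < 1/2. *)
have h0 : 0 < dual_norm h by move: nh1 nh2; rewrite /c /b in b0 bd *; nra.
have [y1 hy] := norm_attained By h0 hmax.
set n := dual_norm h in h0 hy nh1 nh2 *.
(* The multiple [h / n] is obtained as [(h / n + h) - h]. *)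
have [g0 g0E] := dual_lin_exists (of_real k n^-1) h h.
have [g gE] := dual_lin_exists (-1) h g0.
have {g0E} gE z : g z = of_real k n^-1 * h z by rewrite gE g0E; ring.
have gy : g y = 1 by rewrite gE hy -of_realM mulVf ?gt_eqF// of_real1.
exists y, g; split.
- split=> //=; apply/le_anti/andP; split.
    apply: dual_norm_le => // z; rewrite gE mul1r.
    rewrite [X in X <= _](rnormZ _ (h z : K^o)) rnorm_of_real.
    rewrite ger0_norm ?invr_ge0 ?(ltW h0)//.
    by rewrite ler_pdivrMl// dual_norm_bound.
  have := @dual_norm_ge _ _ _ g y.
  rewrite y1 lexx gy -(of_real1 R k) rnorm_of_real normr1.
  exact.
(* Otherwise c s < delta - b, whereas 2 c s = s^2 - b s >= 2 (delta - b). *)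
- rewrite leNgt; apply/negP => sxy.
  have := fM _ By; move: xy; rewrite -(ltr_pM2l c0) in sxy.
  by rewrite /c /b in b0 bd sxy *; nra.
apply: dual_norm_le; first exact: ltW.
move=> z /=; have -> : f z - g z = d z + of_real k (1 - n^-1) *: (h z : K^o).
  by rewrite dE gE of_realD of_realN of_real1 /GRing.scale /=; ring.
rewrite (le_trans (rnormD _ _))// rnormZ rnorm_of_real.
have hz := dual_norm_bound h z; have dz := dual_norm_bound d z.
apply: (@le_trans _ _ (c * rnorm z + `|1 - n^-1| * (n * rnorm z))).
  rewrite lerD// ?ler_wpM2l// (le_trans dz)// ler_wpM2r ?rnorm_ge0//.
  by rewrite -fhd.
rewrite mulrA -mulrDl ler_wpM2r ?rnorm_ge0//.
have -> : `|1 - n^-1| * n = `|n - 1|.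
  rewrite -{2}(gtr0_norm h0) -normrM; congr `|_|.
  by rewrite mulrBl mul1r mulVf ?gt_eqF.
(* [n] is within c of |f| = 1 - b; the total is then at most c + (b + c) = s. *)
have : `|n - 1| <= b + c by rewrite ler_distl; move: b0; rewrite /b; lra.
by rewrite /c; lra.
Qed.

End BishopPhelps.

(** * The lower bound in C0(L, E) *)

(** The sandwich theorem with [p] and [q] both the norm, which is additive on the ray through [e].
    The resulting Re g(e) >= 1 and |g(e)| <= 1 force g(e) = 1. *)
Lemma norming_functional (R : realType) (k : scalars)
    (E : completeNormedModType (scalar_field R k)) (e : E) : rnorm e = 1 ->
  exists g : dual E, dual_norm g <= 1 /\ g e = 1.
Proof.
move=> e1; pose V := realification E.
pose p := fun v : V => rnorm (v : E).
have pZ r v : 0 <= r -> p (r *: v) = r * p v by move=> r0; exact: rnormZr.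
have plin : sublinear p.
  by split=> [u v|r v r0]; [exact: rnormD|rewrite pZ].
have qlin : superlinear_on (ray (e : V)) p.
  split=> [_ _ [r r0 <-] [s s0 <-]|r v r0 _]; last by rewrite pZ.
  by rewrite -scalerDl !pZ ?addr_ge0// mulrDl.
have [h [hlin hp hq]] :=
  sandwich plin (convex_cone_ray (e : V)) qlin (fun c _ => lexx (p c)).
have [v|g [gE g1]] := dual_of_re ler01 hlin; first by rewrite mul1r; exact: hp.
exists g; split=> //.
have ge : 1 <= scalar_re (g e).
  rewrite gE -[leLHS]e1; apply: hq; exists 1; first exact: ler01.
  by rewrite scale1r.
have ge1 : rnorm (g e) <= 1 by rewrite (le_trans _ g1)// dual_norm_ge// e1.
have := scalar_re_le_rnorm (g e) => re.
rewrite (@scalar_eq_of_real R k (g e)); last lra.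
by rewrite -[RHS](of_real1 R k); congr of_real; lra.
Qed.

(** * Cutoff functions on a locally compact Hausdorff space *)

Section Bumps.
Context (R : realType) (L : topologicalType).
Context (L_locally_compact : locally_compact [set: L]).
Context (L_hausdorff : hausdorff_space L).

(** The last clause is vanishing at infinity, a weaker condition than compact support. *)
Definition bump (phi : L -> R) :=
  [/\ continuous phi, forall t, 0 <= phi t, forall t, phi t <= 1 &
      forall eta, 0 < eta -> compact [set t | eta <= phi t]].

Lemma closed_superlevel (phi : L -> R) eta :
  continuous phi -> closed [set t | eta <= phi t].
Proof.
move=> phic; apply: (@preimage_closed _ _ phi [set r | eta <= r]); last exact: closed_ge.
move=> t _; exact: phic.
Qed.

(** Complete regularity separates [t] from [B] together with the complement of the interior of a
    compact neighbourhood [W]; the bump then vanishes outside [W]. *)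
Lemma bump_exists (t : L) (B : set L) : closed B -> ~ B t ->
  exists phi, [/\ bump phi, phi t = 1 & forall r, B r -> phi r = 0].
Proof.
move=> Bcl Bt.
have [W] := L_locally_compact (I : [set: L] t); rewrite withinET => Wt [Wc Wcl].
have /(@uniform_separatorP _ R)[f [fc f01 ft fB]] :
    uniform_separator [set t] (B `|` ~` W°).
  apply: (@locally_compact_completely_regular L R) => //.
    by apply: closedU => //; apply: open_closedC; exact: open_interior.
  by case=> // /(_ Wt).
have f01' r : 0 <= f r <= 1 by have := f01 (f r); rewrite /= in_itv /=; apply; exists r.
exists (fun r => 1 - f r); split.
- split=> [r|r|r|eta eta0].
  + by apply: cvgB; [exact: cvg_cst|exact: fc].
  + by have := f01' r; lra.
  + by have := f01' r; lra.
  apply: subclosed_compact Wc _ => [|r /= fr].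
    by apply: closed_superlevel => r; apply: cvgB; [exact: cvg_cst|exact: fc].
  apply: interior_subset; apply: contrapT => Wr.
  have : f r = 1 by apply: fB; exists r => //; right.
  by move: fr; lra.
- by have -> : f t = 0; [apply: ft; exists t|rewrite subr0].
- by move=> r Br; have -> : f r = 1; [apply: fB; exists r => //; left|rewrite subrr].
Qed.

(** Combines bumps at two points, each vanishing at the other, into one with values 1 and [c]
    there. *)
Lemma bump_max (phi psi : L -> R) (c : R) : 0 <= c -> c <= 1 ->
  bump phi -> bump psi -> bump (fun t => Num.max (phi t) (c * psi t)).
Proof.
move=> c0 c1 [phic phi0 phi1 phiK] [psic psi0 psi1 psiK].
have maxc : continuous (fun t => Num.max (phi t) (c * psi t)).
  move=> t; apply: (@continuous_max R L phi (fun t => c * psi t) t); first exact: phic.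
  by apply: cvgM; [exact: cvg_cst|exact: psic].
split=> // [t|t|eta eta0].
- by rewrite le_max phi0.
- by rewrite ge_max phi1/= mulr_ile1.
apply: subclosed_compact (compactU (phiK _ eta0) (psiK _ eta0)) _.
  exact: closed_superlevel.
move=> t /=; rewrite le_max => /orP[|ct]; [by left|right => /=].
by rewrite (le_trans ct)// ler_piMl.
Qed.

Context (k : scalars) (E : completeNormedModType (scalar_field R k)).

Lemma of_real_continuous : continuous (of_real k : R -> (scalar_field R k)^o).
Proof.
move=> r; apply/cvgrPdist_lt => e e0.
have eE := scalar_reK (ltW e0).
have e0' : 0 < scalar_re e by rewrite -(ltr_of_real k) eE of_real0.
have /cvgrPdist_lt/(_ _ e0') := @cvg_id _ (nbhs r).
apply: filterS => s; rewrite -of_realN -of_realD -of_real_rnorm.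
by rewrite rnorm_of_real -[in X in _ -> X]eE ltr_of_real.
Qed.

Lemma scale_continuous (phi : L -> R) (F : L -> E) : continuous phi ->
  continuous F -> continuous (fun t => of_real k (phi t) *: F t).
Proof.
move=> phic Fc t; apply: cvgZ; last exact: Fc.
by apply: continuous_comp; [exact: phic|exact: of_real_continuous].
Qed.

Lemma bump_C0 (phi : L -> R) (e : E) : bump phi -> rnorm e = 1 ->
  exists x : C0 L E, forall t, x t = of_real k (phi t) *: e.
Proof.
move=> [phic phi0 phi1 phiK] e1.
have fP : (fun t => of_real k (phi t) *: e) \in @C0_pred R k L E.
  apply/C0_predP; split.
    by apply: scale_continuous => // t; exact: cvg_cst.
  move=> eta eta0; have eE := scalar_reK (ltW eta0).
  have eta0' : 0 < scalar_re eta by rewrite -(ltr_of_real k) eE of_real0.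
  rewrite (_ : [set _ | _] = [set t | scalar_re eta <= phi t]); first exact: phiK.
  apply/seteqP; split=> t /=.
    by rewrite -of_real_rnorm rnormZr// e1 mulr1 -{1}eE ler_of_real.
  by rewrite -of_real_rnorm rnormZr// e1 mulr1 -{2}eE ler_of_real.
by exists (MkC0 fP).
Qed.

Lemma C0_mul (phi : L -> R) (x : C0 L E) : bump phi ->
  exists y : C0 L E, forall t, y t = of_real k (phi t) *: x t.
Proof.
move=> [phic phi0 phi1 _].
have cf : continuous (fun t => of_real k (phi t) *: x t).
  by apply: scale_continuous => //; exact: C0_continuous.
have fP : (fun t => of_real k (phi t) *: x t) \in @C0_pred R k L E.
  apply/C0_predP; split=> // eta eta0.
  apply: subclosed_compact (C0_vanishes (f := x) eta0) _; first exact: closed_norm_ge.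
  move=> t /= /le_trans; apply; rewrite -!of_real_rnorm ler_of_real rnormZr//.
  by rewrite ler_piMl ?rnorm_ge0.
by exists (MkC0 fP).
Qed.

End Bumps.

(** * The pair at distance at least [eps] from [Pi_set] *)

Section C0LowerBound.
Context (R : realType) (k : scalars) (L : topologicalType).
Context (E : completeNormedModType (scalar_field R k)).
Local Notation K := (scalar_field R k).
Implicit Types x y w : C0 L E.

Lemma C0_rnormE x : rnorm x = C0_norm x.
Proof. exact: of_realK. Qed.

Lemma C0_unit_ballP x : unit_ball x <-> forall t, rnorm (x t) <= 1.
Proof.
rewrite /unit_ball /= C0_rnormE; split=> [x1 t|x1]; last exact: C0_norm_le.
exact: le_trans (C0_norm_ge x t) x1.
Qed.

(** Where [w] is nonzero, |y| <= m, so y + a w stays in the unit ball whenever |a| = 1 - m. The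
    right phase of [a] gives 1 + (1 - m) |g(w)| <= |g| = 1. *)
Lemma Pi_set_vanish y (g : dual (C0 L E)) w (m : R) : Pi_set (y, g) -> m < 1 ->
    (forall t, rnorm (w t) <= 1) -> (forall t, m < rnorm (y t) -> w t = 0) ->
  g w = 0.
Proof.
move=> [/= y1 g1 gy] m1 w1 wy.
have [u u1 uw] := scalar_rotation (g w).
have y1' : forall t, rnorm (y t) <= 1 by apply/C0_unit_ballP; rewrite /unit_ball /= y1.
pose a := of_real k (1 - m) * u.
have na : rnorm (a : K^o) = 1 - m.
  by rewrite [LHS](rnormZr (u : K^o)) ?u1 ?mulr1// subr_ge0 ltW.
have Bz : unit_ball (a *: w + y).
  apply/C0_unit_ballP => t; rewrite C0D C0Z.
  have [yt|yt] := ltP m (rnorm (y t)); first by rewrite wy// scaler0 add0r.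
  rewrite (le_trans (rnormD _ _))// rnormZ na.
  have : (1 - m) * rnorm (w t) <= 1 - m by rewrite ler_piMr// subr_ge0 ltW.
  by lra.
have := le_trans (scalar_re_le_rnorm _) (dual_norm_ge g Bz).
have -> : g (a *: w + y) = of_real k ((1 - m) * rnorm (g w) + 1).
  by rewrite linearP /= gy of_realD of_realM of_real1 -uw mulrA.
rewrite g1 of_realK gerDr.
rewrite pmulr_rle0 ?subr_gt0// => nw.
by apply: rnorm0_eq0; apply/le_anti; rewrite nw rnorm_ge0.
Qed.

Context (L_locally_compact : locally_compact [set: L]).
Context (L_hausdorff : hausdorff_space L).

Lemma C0_spherical_witness (s t : L) (e : E) (eps : R) :
    s <> t -> e <> 0 -> 0 < eps -> eps <= 1 ->
  exists x (f : dual (C0 L E)), [/\ unit_sphere x, dual_unit_sphere f,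
    scalar_re (f x) = 1 - eps ^+ 2 / 2 &
    forall y g, Pi_set (y, g) -> rnorm (x - y) < eps ->
      eps <= dual_norm (f \- g)].
Proof.
move=> st; wlog e1 : e / rnorm e = 1.
  move=> wl e0; apply: (wl (of_real k (rnorm e)^-1 *: e)).
    rewrite rnormZr ?invr_ge0 ?rnorm_ge0// mulVf//.
    by apply/eqP => /rnorm0_eq0.
  apply/eqP; rewrite scaler_eq0 negb_or of_real_neq0; last first.
    by rewrite invr_eq0; apply/eqP => /rnorm0_eq0.
  exact/eqP.
move=> _ eps0 eps1.
have [es [es1 ese]] := norming_functional e1.
have closed1 (r : L) : closed [set r].
  exact/accessible_closed_set1/hausdorff_accessible.
have [|phis [bs phiss phist]] :=
  @bump_exists R L L_locally_compact L_hausdorff s [set t] (closed1 t);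
  first exact: st.
have [|phit [bt phitt phits]] :=
  @bump_exists R L L_locally_compact L_hausdorff t [set s] (closed1 s);
  first by move=> /esym.
(* [c = 1 - eps] yields the witness [x]; [c = 1] yields a point where [f] takes the value 1, which
   shows |f| = 1. *)
have mkx c : 0 <= c -> c <= 1 ->
    exists x, [/\ unit_ball x, x s = e & x t = of_real k c *: e].
  move=> c0 c1; have bx := bump_max c0 c1 bs bt.
  have [x xE] := bump_C0 bx e1; case: bx => _ b0 b1 _; exists x; split.
  - by apply/C0_unit_ballP => r; rewrite xE rnormZr// e1 mulr1.
  - by rewrite xE phiss phits// mulr0 max_l ?of_real1 ?scale1r ?ler01.
  - by rewrite xE phist// phitt mulr1 max_r.
have esx x r : rnorm (es (x r)) <= rnorm (x r).
  by rewrite (le_trans (dual_norm_bound _ _))// ler_piMl ?rnorm_ge0.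
have f_bound x : rnorm (of_real k (1 - eps / 2) * es (x s) +
    of_real k (eps / 2) * es (x t) : K^o) <= 1 * rnorm x.
  apply: le_trans (rnormD _ _) _.
  rewrite (@rnormZr _ _ _ _ (es (x s) : K^o)); last by lra.
  rewrite (@rnormZr _ _ _ _ (es (x t) : K^o)); last by lra.
  have xs := le_trans (esx x s) (C0_norm_ge x s).
  have xt := le_trans (esx x t) (C0_norm_ge x t).
  by rewrite C0_rnormE; nra.
have [|f fE] := dual_exists _ f_bound.
  by move=> a x y; rewrite !C0D !C0Z !linearP /= /GRing.scale /=; ring.
have f1 : dual_norm f <= 1.
  by apply: dual_norm_le => // x; rewrite fE; exact: f_bound.
have fx c x : x s = e -> x t = of_real k c *: e ->
    f x = of_real k (1 - eps / 2 + eps / 2 * c).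
  move=> xs xt; have esc : es (of_real k c *: e) = of_real k c.
    by rewrite linearZ /= ese; exact: mulr1.
  by rewrite fE xs xt esc ese mulr1 -of_realM -of_realD.
have eps_c : 0 <= 1 - eps by lra.
have eps_c1 : 1 - eps <= 1 by lra.
have [x1 [Bx1 x1s x1t]] := mkx 1 ler01 (lexx _).
have [x [Bx xs xt]] := mkx (1 - eps) eps_c eps_c1.
exists x, f; split.
- rewrite /unit_sphere /=; apply/le_anti; rewrite [rnorm x <= 1]Bx/=.
  by rewrite -[leLHS]e1 -xs C0_rnormE C0_norm_ge.
- rewrite /dual_unit_sphere /=; apply/le_anti; rewrite f1/=.
  have := dual_norm_ge f Bx1; rewrite (fx 1)// rnorm_of_real; apply: le_trans.
  by rewrite mulr1 subrK normr1.
- by rewrite (fx (1 - eps))// of_realK; field.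
move=> y g yg xy; have [/= y1 g1 gy] := yg.
have y_le r : rnorm (y r) <= 1 by rewrite -y1 C0_rnormE C0_norm_ge.
(* |y(t)| <= |y(t) - x(t)| + |x(t)| < eps + (1 - eps). *)
have yt : rnorm (y t) < 1.
  have := C0_norm_ge (x - y) t; rewrite -C0_rnormE C0D C0N.
  have := rnormD (y t - x t) (x t); rewrite subrK rnorm_sym xt rnormZr// e1.
  by lra.
(* Strictly between |y(t)| and 1, so that [t] lies off the closed set where |y| >= m. *)
pose m := (1 + rnorm (y t)) / 2.
have clB : closed [set r | m <= rnorm (y r)].
  apply: closed_superlevel => r; apply: continuous_comp; first exact: C0_continuous.
  exact: rnorm_continuous.
have [|psi [bpsi psit psi0]] :=
  @bump_exists R L L_locally_compact L_hausdorff t _ clB.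
  by rewrite /m /=; lra.
have [w wE] := bump_C0 bpsi e1; have [v vE] := C0_mul y bpsi.
case: bpsi => _ psi_ge0 psi_le1 _.
have m1 : m < 1 by rewrite /m; lra.
have gw : g w = 0.
  apply: (Pi_set_vanish yg m1) => r; rewrite wE ?rnormZr// ?e1 ?mulr1//.
  by move=> /ltW/psi0 ->; rewrite of_real0 scale0r.
have gv : g v = 0.
  apply: (Pi_set_vanish yg m1) => r; rewrite vE ?rnormZr//.
    by rewrite mulr_ile1 ?rnorm_ge0.
  by move=> /ltW/psi0 ->; rewrite of_real0 scale0r.
(* Here w = psi e and v = psi y are both killed by [g], so g(u) = -g(y). *)
pose u := w + (v - y).
have uE r : u r = of_real k (psi r) *: e - of_real k (1 - psi r) *: y r.
  rewrite /u !C0D C0N wE vE of_realD of_realN of_real1 scalerBl scale1r.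
  by rewrite opprB.
have u1 r : rnorm (u r) <= 1.
  rewrite uE (le_trans (rnormD _ _))// rnormN !rnormZr ?subr_ge0// e1 mulr1.
  have := y_le r; have := psi_le1 r; nra.
have Bu : unit_ball u by apply/C0_unit_ballP.
have gu : g u = -1 by rewrite /u linearD linearB /= gw gv gy !add0r.
have ut : u t = e by rewrite uE psit of_real1 scale1r subrr of_real0 scale0r subr0.
(* The value u(t) = e contributes eps/2, and the term at [s] is at least -(1 - eps/2). *)
have fu : -1 + eps <= scalar_re (f u).
  rewrite fE scalar_reD !scalar_reZ ut ese -(of_real1 R k) of_realK mulr1.
  have := scalar_re_le_rnorm (- es (u s)); rewrite scalar_reN rnormN.
  have := le_trans (esx u s) (u1 s); nra.
have [d dE] := dual_lin_exists (-1) g f.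
have -> : dual_norm (f \- g) = dual_norm d.
  by congr dual_norm; apply/funext => z /=; rewrite dE mulN1r addrC.
apply: le_trans (dual_norm_ge d Bu); apply: le_trans (scalar_re_le_rnorm _).
rewrite dE gu scalar_reD mulrNN mulr1 -(of_real1 R k) of_realK; lra.
Qed.

End C0LowerBound.

(** Non-strict approximation within [s] puts every [e > s] in the set defining the infimum, and the
    far pairs exclude every [e < s]; whether [s] itself belongs does not affect the infimum. *)
Lemma BPB_modulus_on_eq (R : realType) (k : scalars)
    (X : completeNormedModType (scalar_field R k)) (A : set X) (B : set (dual X))
    (delta s : R) : 0 < s ->
    (forall x f, A x -> B f -> 1 - delta < scalar_re (f x) ->
      exists y g, [/\ Pi_set (y, g), rnorm (x - y) <= s & dual_norm (f \- g) <= s]) ->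
    (forall e, 0 < e -> e < s -> exists x f,
      [/\ A x, B f, 1 - delta < scalar_re (f x) &
       forall y g, Pi_set (y, g) -> rnorm (x - y) < e -> e <= dual_norm (f \- g)]) ->
  BPB_modulus_on A B delta = s.
Proof.
move=> s0 upper lower; rewrite /BPB_modulus_on; set S := (X in inf X).
have S_gt e : s < e -> S e.
  move=> se; split=> [|x f Ax Bf fx]; first exact: lt_trans se.
  have [y [g [yg xy fg]]] := upper x f Ax Bf fx.
  by exists y, g; split=> //; [exact: le_lt_trans xy se|exact: le_lt_trans fg se].
apply/le_anti/andP; split; last first.
  apply: lb_le_inf => [|e [e0 Se]].
    by exists (s + 1); apply: S_gt; rewrite ltrDl.
  rewrite leNgt; apply/negP => es.
  have [||x [f [Ax Bf fx far]]] := lower ((e + s) / 2); [lra..|].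
  have [y [g [yg xy fg]]] := Se x f Ax Bf fx.
  have xy' : rnorm (x - y) < (e + s) / 2 by lra.
  by have := far y g yg xy'; lra.
rewrite leNgt; apply/negP => sS.
have : inf S <= (s + inf S) / 2; last by lra.
by apply: ge_inf; [exists 0 => e [/ltW]|apply: S_gt; lra].
Qed.

Theorem mainTheorem12 (R : realType) (k : scalars) (L : topologicalType)
  (E : completeNormedModType (scalar_field R k))
  (L_locally_compact : locally_compact [set: L])
  (L_hausdorff : hausdorff_space L)
  (L_two_points : exists s t : L, s <> t)
  (E_nonzero : exists e : E, e <> 0)
  (delta : R) (delta_gt0 : 0 < delta) (delta_le : delta <= 1 / 2) :
  BPB_modulus (C0 L E) delta = Num.sqrt (2 * delta) /\
  spherical_BPB_modulus (C0 L E) delta = Num.sqrt (2 * delta).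
Proof.
have [a [b ab]] := L_two_points; have [e e0] := E_nonzero.
set s := Num.sqrt (2 * delta).
have s2 : s ^+ 2 = 2 * delta by rewrite sqr_sqrtr// mulr_ge0// ltW.
have s0 : 0 < s by rewrite sqrtr_gt0 mulr_gt0.
(* Since the spheres lie in the balls, spherical witnesses give the lower bound for both moduli, and
   the upper bound on the balls covers the spheres. *)
have far eps : 0 < eps -> eps < s -> exists (x : C0 L E) (f : dual (C0 L E)),
    [/\ unit_sphere x, dual_unit_sphere f, 1 - delta < scalar_re (f x) &
     forall y g, Pi_set (y, g) -> rnorm (x - y) < eps ->
       eps <= dual_norm (f \- g)].
  move=> eps0 epss; have eps1 : eps <= 1 by nra.
  have [x [f [x1 f1 fx xf]]] :=
    C0_spherical_witness L_locally_compact L_hausdorff ab e0 eps0 eps1.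
  (* Here eps^2 / 2 < s^2 / 2 = delta. *)
  by exists x, f; split=> //; rewrite fx; nra.
split; apply: BPB_modulus_on_eq => //.
- by move=> x f; exact: bishop_phelps_bollobas.
- move=> eps eps0 /(far eps eps0)[x [f [x1 f1 fx xf]]]; exists x, f; split=> //.
    by rewrite /unit_ball /= x1.
  by rewrite /dual_unit_ball /= f1.
move=> x f x1 f1; apply: bishop_phelps_bollobas => //.
  by rewrite /unit_ball /= x1.
by rewrite /dual_unit_ball /= f1.
Qed.
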